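(* Let $K$ be a zero-dimensional compact Hausdorff space whose set of isolated points is dense in $K$, and such that the set $K'$ of accumulation points of $K$ is a $G_\delta$ subset of $K$. Let $F:B_{C(K)}\to B_{C(K)}$ be a non-expansive bijection. Then $F$ is an isometry under either of the following additional assumptions: (i) $F$ has property $( * )$: for any $u,v,z\in K$ with $u\neq v$ and any sign $\omega\in\{-1,1\}$, there exists $f\in B_{C(K)}$ such that $f(u)f(v)$ is non-zero with sign $\omega$ and $|F(f)|\equiv 1$ on some neighbourhood of $z$; (ii) $\inf\{\|F(\omega\mathds{1}_{\{a\}})\| : a\in K\setminus K',\ \omega=\pm1\}>1/2$.
   Context: $C(K)$ is the Banach space of real-valued continuous functions on $K$ with the supremum norm and $B_{C(K)}$ its closed unit ball. A topological space is zero-dimensional if it has a basis of clopen sets. A map is non-expansive if it is $1$-Lipschitz. $\mathds{1}_{\{a\}}$ is the indicator function of $\{a\}$ (continuous when $a$ is isolated). *)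

(* Defs.v *)
From HB Require Import structures.
From mathcomp Require Import all_boot all_order all_algebra.
From mathcomp Require Import all_classical all_reals all_analysis.
From mathcomp Require Export borel_hierarchy.
Set Implicit Arguments. Unset Strict Implicit. Unset Printing Implicit Defensive.
Import Order.TTheory GRing.Theory Num.Theory.
Import numFieldNormedType.Exports.
Local Open Scope classical_set_scope.
Local Open Scope ring_scope.

(* Zero-dimensional in the paper's sense: a basis of clopen sets. *)
Definition clopen_basis (T : topologicalType) :=
  forall (x : T) (U : set T), open U -> U x ->
    exists V : set T, [/\ clopen V, V x & V `<=` U].

Definition isolated_pt (T : topologicalType) (x : T) := nbhs x [set x].

Definition accum_pts (T : topologicalType) : set T := [set x | ~ isolated_pt x].

Record BC (R : realType) (K : topologicalType) := MkBC {
  bc_fun :> K -> R ;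
  bc_cont : continuous bc_fun ;
  bc_le1 : forall x, `|bc_fun x| <= 1 }.

Definition supdist (R : realType) (K : topologicalType) (f g : K -> R) : R :=
  sup [set `|f x - g x| | x in [set: K]].

Definition supnorm (R : realType) (K : topologicalType) (f : K -> R) : R :=
  sup [set `|f x| | x in [set: K]].

Definition bc_non_expansive (R : realType) (K : topologicalType)
  (F : BC R K -> BC R K) :=
  forall f g, supdist (F f) (F g) <= supdist f g.

Definition bc_isometry (R : realType) (K : topologicalType)
  (F : BC R K -> BC R K) :=
  forall f g, supdist (F f) (F g) = supdist f g.

Definition property_star (R : realType) (K : topologicalType)
  (F : BC R K -> BC R K) :=
  forall (u v z : K) (w : R), u <> v -> (w = 1 \/ w = -1) ->
    exists f : BC R K,
      0 < w * (f u * f v) /\ \forall y \near z, `|F f y| = 1.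

Definition cond_ii (R : realType) (K : topologicalType)
  (F : BC R K -> BC R K) :=
  exists2 c : R, 1 / 2 < c &
    forall (a : K) (w : R) (g : BC R K), isolated_pt a -> (w = 1 \/ w = -1) ->
      (forall x, g x = if x == a then w else 0) ->
      c <= supnorm (F g).

(* Main.v *)
(**
Write [G] for the inverse of [F] and call [y] unimodular if [|y| = 1]
everywhere. Since the midpoint of 0 and [y] is unique exactly when [y] is
unimodular, [G] preserves unimodular functions. If [y] is unimodular then
[|f - y| = 1 - f * y], so by non-expansiveness every lower bound of [f * G y] is
one of [F f * y]. For an isolated point [b], one of [F 1_b * y] and [F (-1_b) * y]
is nonnegative, according to the sign of [G y] at [b]; as [y] is arbitrary, both
images live on a single isolated point [point_map b], with opposite signs. Hence
[G y = phase * (y \o point_map)] for all unimodular [y], where [point_map]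
extends to a continuous surjection of [K] onto itself that is injective over the
images of isolated points. Put [lift h = phase * (h \o point_map)].

It remains to see that [F (lift h) = h] for all [h], for then [lift] inverts [F]
and [F] is an isometry. Suppose that [|F f| > d] at [point_map b] forces [f b]
to have the right sign. A function [y * q] with [y] unimodular and [q > d] is
approximated by [y * p], where [p] takes distinct values on the (countably many)
isolated points and well-orders them; then [F (lift (y * p)) = y * p] by
induction along this order, comparing with the functions that agree with [y * p]
on an initial segment and with [y] elsewhere. Under (ii) this applies with some
[d < 1], so [F (lift g) = g] for [g] small, which makes [lift] surjective; under
(i) [point_map] is injective, so [lift] is again surjective. Once [lift] is
surjective one can take [d = 0], and nowhere vanishing functions are dense.
*)
Require Import Defs.
From HB Require Import structures.
From mathcomp Require Import all_boot all_order all_algebra.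
From mathcomp Require Import all_classical all_reals all_analysis.
From mathcomp Require Import borel_hierarchy.
From mathcomp Require Import lra.
Set Implicit Arguments.
Unset Strict Implicit.
Unset Printing Implicit Defensive.
Import Order.TTheory GRing.Theory Num.Theory.
Import numFieldNormedType.Exports.
Local Open Scope classical_set_scope.
Local Open Scope ring_scope.

(** * Clopen sets and isolated points *)

Section clopen_sets.
Context {K : topologicalType}.
Implicit Types (A U : set K) (x a : K).

Lemma continuous_if_clopen {T : topologicalType} (P : pred K) (f g : K -> T) :
  clopen [set x | P x] -> continuous f -> continuous g ->
  continuous (fun x => if P x then f x else g x).
Proof.
move=> cP cf cg; apply/continuous_subspace_setT; rewrite -(setUv [set x | P x]).
apply: withinU_continuous; [by case: cP|by case: (clopenC [set x | P x] cP)|..].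
- apply: (@subspace_eq_continuous _ _ _ f); last exact: continuous_subspaceT.
  by move=> x /set_mem /= Px; rewrite /from_subspace Px.
- apply: (@subspace_eq_continuous _ _ _ g); last exact: continuous_subspaceT.
  by move=> x /set_mem /= /negP/negbTE Px; rewrite /from_subspace Px.
Qed.

Lemma finite_isolated_clopen A : hausdorff_space K ->
  finite_set A -> A `<=` @isolated_pt K -> clopen A.
Proof.
move=> Khaus fA Ai; split; last first.
  by have /accessible_finite_set_closed := hausdorff_accessible Khaus; exact.
by rewrite openE => x Ax; apply: (filterS _ (Ai _ Ax)) => _ ->.
Qed.

Lemma isolated_clopen a : hausdorff_space K -> isolated_pt a -> clopen [set a].
Proof. by move=> Khaus ia; apply: finite_isolated_clopen => // _ ->. Qed.

Lemma clopen_asbool (C : set K) : clopen C -> clopen [set x | `[< C x >]].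
Proof. by congr clopen; apply/seteqP; split=> x /asboolP. Qed.

Lemma clopen_discrete_preimage {D : discreteTopologicalType} (s : K -> D)
  (B : set D) : continuous s -> clopen (s @^-1` B).
Proof.
by apply: preimage_clopen; split; [exact: discrete_open|exact: discrete_closed].
Qed.

Lemma continuous_discrete_comp {D : discreteTopologicalType}
  {T : topologicalType} (g : D -> T) (s : K -> D) :
  continuous s -> continuous (g \o s).
Proof.
move=> cs x; apply: (near_cst_continuous (g (s x))).
have : nbhs x (s @^-1` [set s x]) by apply: cs; exact: discrete_set1.
by apply: filterS => z /= ->.
Qed.

Lemma compact_local_ind A (I : set (set K)) : compact A -> I set0 ->
  setU_closed I -> (forall B C, B `<=` C -> I C -> I B) ->
  (forall x, A x -> exists2 B, nbhs x B & I B) -> I A.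
Proof.
move=> cA I0 IU IS Iloc; apply: contrapT => nIA.
pose G : set_system K := filter_from I (fun B => A `\` B).
have PG : ProperFilter G.
  apply: filter_from_proper.
    apply: filter_from_filter; first by exists set0.
    move=> B C IB IC; exists (B `|` C); first exact: IU.
    by rewrite setDUr.
  move=> B IB; apply: contrapT => /set0P/negP/negPn/eqP AB; apply: nIA.
  by apply: IS IB; rewrite -setD_eq0.
have GA : G A by exists set0; rewrite ?setD0.
have [x [Ax clx]] := cA G PG GA; have [B xB IB] := Iloc _ Ax.
have GB : G (A `\` B) by exists B.
by have [y [[_ nBy] By]] := clx _ _ GB xB.
Qed.

Lemma clopen_separation A U : compact A -> clopen_basis K ->
  open U -> A `<=` U -> exists C, [/\ clopen C, A `<=` C & C `<=` U].
Proof.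
move=> cA K0dim oU AU.
apply: (@compact_local_ind A
  [set B | exists C, [/\ clopen C, B `<=` C & C `<=` U]] cA).
- by exists set0; split => //; exact: clopen0.
- move=> B1 B2 [C1 [clC1 BC1 CU1]] [C2 [clC2 BC2 CU2]]; exists (C1 `|` C2).
  by split; [exact: clopenU|exact: setUSS|rewrite subUset].
- by move=> B B' BB' [C [clC BC CU]]; exists C; split => //; exact: subset_trans BC.
- move=> x /AU Ux; have [V [[oV cV] Vx VU]] := K0dim x U oU Ux.
  by exists V; [exact: open_nbhs_nbhs|exists V; split].
Qed.

Lemma compact_isolated_finite A : compact A -> A `<=` @isolated_pt K ->
  finite_set A.
Proof.
move=> cA Ai; apply: (compact_local_ind cA).
- exact: finite_set0.
- by move=> B C fB fC; rewrite finite_setU.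
- by move=> B C; exact: sub_finite_set.
- by move=> x /Ai ix; exists [set x] => //; exact: finite_set1.
Qed.

Lemma isolated_countable : compact [set: K] ->
  Gdelta (@accum_pts K) -> countable [set x : K | isolated_pt x].
Proof.
move=> Kcpt [U oU accE].
have isoE : [set x : K | isolated_pt x] = \bigcup_i ~` U i.
  rewrite -setC_bigcap -accE; apply/seteqP; split => x; last exact: contrapT.
  by move=> ix; exact.
rewrite isoE; apply: bigcup_countable => // i _; apply: finite_set_countable.
apply: compact_isolated_finite.
  exact: (subclosed_compact (open_closedC (oU i)) Kcpt).
move=> x nUx; have : (\bigcup_i ~` U i) x by exists i.
by rewrite -isoE.
Qed.

Hypothesis Kiso_dense : dense [set x : K | isolated_pt x].

Lemma isolated_near x U : nbhs x U -> exists2 b, isolated_pt b & U b.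
Proof.
move=> /nbhs_interior Ux.
have [|b [Ub ib]] := Kiso_dense _ (@open_interior _ U).
  by exists x; exact: nbhs_singleton.
by exists b => //; exact: interior_subset.
Qed.

Lemma within_isolated_proper x :
  ProperFilter (within [set b | isolated_pt b] (nbhs x)).
Proof.
apply: Build_ProperFilter_ex => A /isolated_near[b ib Ab].
by exists b; exact: Ab.
Qed.

Lemma le_of_le_isolated {R : realType} (f g : K -> R) x :
  {for x, continuous f} -> {for x, continuous g} ->
  (\forall b \near x, isolated_pt b -> f b <= g b) -> f x <= g x.
Proof.
move=> cf cg fg; have PW := within_isolated_proper x.
by apply: (@ler_cvg_to _ _ PW R f g); [exact: cvg_within_filter..|].
Qed.

End clopen_sets.

(** * The unit ball of C(K) *)

Section sign_arithmetic.
Context {R : realType}.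
Implicit Types a b c w : R.

Lemma normr_eq1 w : `|w| = 1 <-> w = 1 \/ w = -1.
Proof.
split=> [/eqP|[->|->]]; rewrite ?normrN ?normr1//.
by rewrite eqr_norml ler01 andbT => /orP[]/eqP; [left|right].
Qed.

Lemma normr1_sqr w : `|w| = 1 -> w * w = 1.
Proof. by move=> w1; rewrite -expr2 -(real_normK (num_real w)) w1 expr1n. Qed.

Lemma normr1_neq0 w : `|w| = 1 -> w != 0.
Proof. by move=> w1; rewrite -normr_eq0 w1 oner_eq0. Qed.

Lemma normr1_mul_eq a w : `|a| = 1 -> `|w| = 1 -> 0 < a * w -> a = w.
Proof. by move=> /normr_eq1[]-> /normr_eq1[]->//; lra. Qed.

Lemma distr_normr1 a w : `|w| = 1 -> `|a| <= 1 -> `|a - w| = 1 - a * w.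
Proof.
move=> w1 a1; rewrite -[LHS]mulr1 -{1}w1 -normrM mulrBl normr1_sqr// distrC.
by rewrite ger0_norm// subr_ge0 (le_trans (ler_norm _))// normrM w1 mulr1.
Qed.

Lemma mulr_sgN a : a * - Num.sg a = - `|a|.
Proof. by rewrite mulrN mulrC -normrEsg. Qed.

Lemma normr_sgN a : a != 0 -> `|- Num.sg a| = 1.
Proof. by move=> a0; rewrite normrN normr_sg a0. Qed.

Lemma mulr_gt0_of_signs a b c : 0 < a * c -> 0 < b * c -> 0 < a * b.
Proof. by case: (ltgtP a 0) => [?|?|->]; case: (ltgtP b 0) => [?|?|->]; nra. Qed.

Lemma mulr_lt0_of_signs a b c : 0 < a * c -> b * c < 0 -> a * b < 0.
Proof.
move=> ac; rewrite -oppr_gt0 -mulNr -(oppr_gt0 (a * b)) -mulrN.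
exact: mulr_gt0_of_signs.
Qed.

Lemma distr_mulr1 a b w : `|w| = 1 -> `|a * w - b * w| = `|a - b|.
Proof. by move=> w1; rewrite -mulrBl normrM w1 mulr1. Qed.

End sign_arithmetic.

Section unit_ball.
Context {R : realType} {K : topologicalType}.
Implicit Types (f g h y : BC R K) (q : K -> R) (x a : K) (c t w : R).

Lemma bc_ext f g : (forall x, f x = g x) -> f = g.
Proof.
case: f g => [f cf bf] [g cg bg] /= /funext fg; case: _ / fg in cg bg *.
by rewrite (Prop_irrelevance cf cg) (Prop_irrelevance bf bg).
Qed.

Lemma bc_ge_le f x : -1 <= f x <= 1.
Proof. by rewrite -ler_norml bc_le1. Qed.

Lemma supdist_ge f g x : `|f x - g x| <= supdist f g.
Proof.
apply: ub_le_sup; last by exists x.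
exists 2 => _ [z _ <-]; rewrite (le_trans (ler_normB _ _))//.
by rewrite (_ : 2 = 1 + 1)// lerD// bc_le1.
Qed.

Lemma supdist_le (f g : K -> R) c : 0 <= c ->
  (forall x, `|f x - g x| <= c) -> supdist f g <= c.
Proof.
move=> c0 fgc; rewrite /supdist.
have [->|/set0P S0] := eqVneq [set `|f x - g x| | x in [set: K]] set0.
  by rewrite sup0.
by apply: sup_le_ub => //= _ [x _ <-].
Qed.

Lemma supdist_ge0 f g : 0 <= supdist f g.
Proof.
have [[x _]|K0] := pselect (exists x : K, True).
  exact: le_trans (normr_ge0 _) (supdist_ge f g x).
rewrite /supdist (_ : [set _ | _ in _] = set0) ?sup0//.
by rewrite -subset0 => r [x]; case: K0; exists x.
Qed.

Lemma supdist_attained f g x0 : compact [set: K] ->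
  exists x, supdist f g = `|f x - g x|.
Proof.
move=> Kcpt; have cfg : continuous (fun x => `|f x - g x|).
  by move=> x; apply: cvg_norm; apply: cvgB; exact: bc_cont.
have K0 : [set: K] !=set0 by exists x0.
have [x _ xmax] := compact_EVT_max K0 Kcpt (continuous_subspaceT cfg).
exists x; apply/eqP; rewrite eq_le supdist_ge andbT; apply: supdist_le => // z.
by apply: xmax; rewrite inE.
Qed.

Definition bc_cst c (c1 : `|c| <= 1) : BC R K :=
  MkBC (@cst_continuous _ _ c) (fun=> c1).

Fact normr0_le1 : `|0 : R| <= 1. Proof. by rewrite normr0. Qed.

Definition bc0 := bc_cst normr0_le1.

Fact normr1_le1 : `|1 : R| <= 1. Proof. by rewrite normr1. Qed.

Definition bc1 := bc_cst normr1_le1.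

Fact bc_mul_continuous f g : continuous (fun x => f x * g x).
Proof. by move=> x; apply: cvgM; exact: bc_cont. Qed.

Fact bc_mul_le1 f g x : `|f x * g x| <= 1.
Proof. by rewrite normrM mulr_ile1// bc_le1. Qed.

Definition bc_mul f g := MkBC (@bc_mul_continuous f g) (bc_mul_le1 f g).

Fact bc_comp_continuous (s : K -> K) f : continuous s -> continuous (f \o s).
Proof. by move=> cs x; apply: continuous_comp; [exact: cs|exact: bc_cont]. Qed.

Definition bc_comp (s : K -> K) (cs : continuous s) f :=
  MkBC (@bc_comp_continuous s f cs) (fun x => bc_le1 f (s x)).

Fact bc_if_le1 (P : pred K) f g x : `|if P x then f x else g x| <= 1.
Proof. by case: ifP => _; exact: bc_le1. Qed.

Definition bc_if (P : pred K) (cP : clopen [set x | P x]) f g :=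
  MkBC (continuous_if_clopen cP (@bc_cont _ _ f) (@bc_cont _ _ g))
       (bc_if_le1 P f g).

Definition unimodular y := forall x, `|y x| = 1.

Lemma bc1_unimodular : unimodular bc1.
Proof. by move=> x; exact: normr1. Qed.

Lemma unimodular_near y x : unimodular y -> \forall z \near x, y z = y x.
Proof.
move=> y1; have yx0 : 0 < y x * y x by rewrite normr1_sqr.
have /(cvgr_gt (y x * y x)) : (y z * y x) @[z --> x] --> y x * y x.
  by apply: cvgM; [exact: bc_cont|exact: cvg_cst].
by move=> /(_ _ yx0); apply: filterS => z; exact: normr1_mul_eq.
Qed.

Lemma unimodular_cst w : `|w| = 1 ->
  exists2 y, unimodular y & forall x, y x = w.
Proof.
move=> w1; have w_le1 : `|w| <= 1 by rewrite w1.
by exists (bc_cst w_le1).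
Qed.

Lemma unimodular_if (P : pred K) : clopen [set x | P x] ->
  exists2 y, unimodular y & forall x, y x = if P x then 1 else -1.
Proof.
have [p p1 pE] := unimodular_cst (normr1 R).
have [m m1 mE] := unimodular_cst (normrN1 R).
move=> cP; exists (bc_if cP p m) => x /=; last by rewrite pE mE.
by case: ifP => _; [exact: p1|exact: m1].
Qed.

Definition is_spike a t (f : K -> R) := forall x, f x = if x == a then t else 0.

Lemma supnorm_spike a t (f : K -> R) : is_spike a t f -> supnorm f = `|t|.
Proof.
move=> fE; apply/le_anti/andP; split.
  apply: sup_le_ub; first by exists `|f a|, a.
  by move=> _ [x _ <-]; rewrite fE; case: ifP; rewrite ?normr0.
apply: ub_le_sup; last by exists a; rewrite // fE eqxx.
by exists `|t| => _ [x _ <-]; rewrite fE; case: ifP; rewrite ?normr0.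
Qed.

Section update.
Hypothesis Khaus : hausdorff_space K.

Fact clopen_pred1 a : isolated_pt a -> clopen [set x | pred1 a x].
Proof.
move=> /(isolated_clopen Khaus); congr clopen.
by apply/seteqP; split=> x /eqP.
Qed.

Definition bc_update a (ia : isolated_pt a) t (t1 : `|t| <= 1) f :=
  bc_if (clopen_pred1 ia) (bc_cst t1) f.

Lemma unit_spike_exists a w : isolated_pt a -> `|w| = 1 ->
  exists f : BC R K, is_spike a w f.
Proof.
move=> ia w1; have w_le1 : `|w| <= 1 by rewrite w1.
by exists (bc_update ia w_le1 bc0).
Qed.

Lemma unimodular_update y a w : unimodular y -> isolated_pt a -> `|w| = 1 ->
  exists2 h, unimodular h & forall x, h x = if x == a then w else y x.
Proof.
move=> y1 ia w1; have w_le1 : `|w| <= 1 by rewrite w1.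
by exists (bc_update ia w_le1 y) => // x /=; case: ifP.
Qed.

End update.

Section zero_dimensional.
Hypotheses (Kcpt : compact [set: K]) (K0dim : clopen_basis K).

Lemma clopen_level q (a b : R) : continuous q -> a < b ->
  exists P : pred K, [/\ clopen [set x | P x],
    forall x, b <= q x -> P x & forall x, P x -> a < q x].
Proof.
move=> cq ab.
have cA : closed [set x | b <= q x].
  exact: (continuous_closedP q).1 cq _ (@closed_ge R b).
have oU : open [set x | a < q x].
  exact: (continuousP q).1 cq _ (@open_gt R a).
have AU : [set x | b <= q x] `<=` [set x | a < q x].
  by move=> x /=; exact: lt_le_trans.
have kA : compact [set x | b <= q x] by exact: subclosed_compact cA Kcpt _.
have [C [clC AC CU]] := clopen_separation kA K0dim oU AU.
exists (fun x => `[< C x >]); split => [|x /AC/asboolP//|x /asboolP/CU//].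
exact: clopen_asbool.
Qed.

Lemma unimodular_separating a U : open U -> U a ->
  exists2 y, unimodular y & forall x, 0 < y x * y a -> U x.
Proof.
move=> oU Ua; have [C [clC Ca CU]] := K0dim oU Ua.
have [y y1 yE] := unimodular_if (clopen_asbool clC); exists y => // x.
by rewrite !yE (asboolT Ca) mulr1; case: asboolP => [/CU//|_]; rewrite ltr0N1.
Qed.

Lemma unimodular_almost_aligned f c : 0 < c ->
  exists2 y, unimodular y & forall x, - c <= f x * y x.
Proof.
move=> c0; have [|P [clP Pge Plt]] := @clopen_level f (- c) c (@bc_cont _ _ f).
  by rewrite gt0_cp.
have [y y1 yE] := unimodular_if clP; exists y => // x; rewrite yE.
case: ifPn => [/Plt|/negP nP]; first by rewrite mulr1; exact: ltW.
by rewrite mulrN1 lerN2 leNgt; apply/negP => /ltW/Pge.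
Qed.

Lemma nonvanishing_approx g c : 0 < c <= 1 -> exists y h,
  [/\ unimodular y, forall x, `|g x - h x| <= 2 * c & forall x, c <= h x * y x].
Proof.
move=> /andP[c0 c1]; have [y y1 gy] := unimodular_almost_aligned g c0.
pose q x := Num.max (g x * y x) c.
have q_norm x : `|q x| = q x by rewrite ger0_norm// le_max (ltW c0) orbT.
have ch : continuous (fun x => y x * q x).
  move=> x; apply: cvgM; first exact: bc_cont.
  apply: (@continuous_max R K (bc_mul g y) (cst c)); first exact: bc_cont.
  exact: cst_continuous.
have h1 x : `|y x * q x| <= 1.
  rewrite normrM y1 mul1r q_norm ge_max c1 andbT.
  exact: ler_normlW (bc_le1 (bc_mul g y) x).
exists y, (MkBC ch h1); split=> // x /=; last first.
  by rewrite mulrAC normr1_sqr// mul1r le_max lexx orbT.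
rewrite -[leLHS]mulr1 -{1}(y1 x) -normrM mulrBl mulrAC normr1_sqr// mul1r.
by rewrite /q ler_norml; have := gy x; case: (leP (g x * y x) c); lra.
Qed.

End zero_dimensional.
End unit_ball.

(** * Functions that well-order the isolated points *)

Section well_orders_isolated.
Context {R : realType} {K : topologicalType}.
Implicit Types (p : K -> R) (a x : K).

Definition well_orders_isolated p := [/\
  forall a, isolated_pt a -> clopen [set x | p x < p a],
  forall a x, isolated_pt a -> p x = p a -> x = a &
  well_founded (fun a b => isolated_pt a /\ p a < p b)].

Lemma well_orders_isolated_scale p (c : R) : 0 < c ->
  well_orders_isolated p -> well_orders_isolated (fun x => c * p x).
Proof.
move=> c0; have ltE x z : (c * p x < c * p z) = (p x < p z) by rewrite ltr_pM2l.
case=> pclo pinj pwf; split=> [a ia|a x ia|a].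
- by have := pclo a ia; congr clopen; apply/seteqP; split=> x /=; rewrite ltE.
- by move=> /(mulfI (lt0r_neq0 c0)); exact: pinj.
- by elim: (pwf a) => {}a _ IH; constructor => b; rewrite ltE; exact: IH.
Qed.

Section rank.
Hypothesis Khaus : hausdorff_space K.
Context {n : K -> nat}.
Hypothesis n_inj : {in [set x | isolated_pt x] &, injective n}.

Definition isolated_weight x : R :=
  if `[< isolated_pt x >] then (n x).+1%:R^-1 else 0.

Lemma isolated_weight_ge0_le1 x : 0 <= isolated_weight x <= 1.
Proof.
rewrite /isolated_weight; case: ifP => _; last by rewrite lexx ler01.
by rewrite invr_ge0 ler0n invf_le1 ?ltr0n// ler1n.
Qed.

Lemma isolated_weight_lt a x : isolated_pt a ->
  (isolated_weight a < isolated_weight x) = `[< isolated_pt x >] && (n x < n a)%N.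
Proof.
move=> ia; rewrite /isolated_weight asboolT//; case: ifP => _ /=.
  by rewrite ltf_pV2 ?posrE ?ltr0n// ltr_nat ltnS.
by apply/negbTE; rewrite -leNgt invr_ge0 ler0n.
Qed.

Lemma isolated_weight_inj a x : isolated_pt a ->
  isolated_weight x = isolated_weight a -> x = a.
Proof.
move=> ia; rewrite /isolated_weight (asboolT ia); case: asboolP => [ix|_].
  by move/invr_inj/eqP; rewrite eqr_nat eqSS => /eqP; apply: n_inj; rewrite inE.
by move/esym/eqP; rewrite invr_eq0 pnatr_eq0.
Qed.

Lemma finite_isolated_lt m : finite_set [set x | isolated_pt x /\ (n x < m)%N].
Proof.
have n_inj_m : {in [set x | isolated_pt x /\ (n x < m)%N] &, injective n}.
  by move=> x z /set_mem[ix _] /set_mem[iz _]; apply: n_inj; rewrite inE.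
rewrite -(eq_finite_set (inj_card_eq n_inj_m)).
by apply: (sub_finite_set _ (finite_II m)) => _ [x [_ xm] <-].
Qed.

Lemma clopen_isolated_lt m : clopen [set x | isolated_pt x /\ (n x < m)%N].
Proof. by apply: (finite_isolated_clopen Khaus (finite_isolated_lt m)) => x []. Qed.

Lemma isolated_weight_continuous : continuous isolated_weight.
Proof.
move=> x; have [ix|nix] := pselect (isolated_pt x).
  by apply: (near_cst_continuous (isolated_weight x)); apply: filterS ix => z ->.
have wx0 : isolated_weight x = 0 by rewrite /isolated_weight asboolF.
rewrite /continuous_at wx0; apply/cvgr0Pnorm_lt => e e0.
have [_ /closed_openC oC] := clopen_isolated_lt (Num.bound e^-1).
have : nbhs x (~` [set z | isolated_pt z /\ (n z < Num.bound e^-1)%N]).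
  by apply: open_nbhs_nbhs; split => // -[].
apply: filterS => z /= nz; rewrite /isolated_weight.
case: asboolP => [iz|_]; last by rewrite normr0.
rewrite ger0_norm ?invr_ge0// invf_plt ?posrE ?ltr0n//.
apply: (lt_le_trans (archi_boundP _)); first by rewrite invr_ge0 ltW.
by rewrite ler_nat leqW// leqNgt; apply/negP => ?; exact: nz.
Qed.

Context {s : K -> nat}.
Hypothesis s_cont : continuous s.

Definition rank x : R := (s x)%:R - isolated_weight x / 2.

Lemma rank_continuous : continuous rank.
Proof.
have cs := @continuous_discrete_comp _ _ _ (fun k => k%:R : R) _ s_cont.
move=> x; apply: cvgB; first exact: cs.
by apply: cvgM; [exact: isolated_weight_continuous|exact: cvg_cst].
Qed.

Lemma rank_lt_of_lt x z : (s x < s z)%N -> rank x < rank z.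
Proof.
rewrite /rank -(ler_nat R) -natr1.
by have := isolated_weight_ge0_le1 x; have := isolated_weight_ge0_le1 z; lra.
Qed.

Lemma rank_ltE a x : isolated_pt a -> (rank x < rank a) =
  (s x < s a)%N || [&& s x == s a, `[< isolated_pt x >] & (n x < n a)%N].
Proof.
move=> ia; have [sxa|sax|sxa] := ltngtP (s x) (s a) => /=.
- exact: rank_lt_of_lt.
- by apply/negbTE; rewrite -leNgt ltW// rank_lt_of_lt.
- by rewrite -isolated_weight_lt// /rank sxa ltrD2l ltrN2 ltr_pM2r ?invr_gt0.
Qed.

Lemma rank_inj a x : isolated_pt a -> rank x = rank a -> x = a.
Proof.
move=> ia xa; have [/rank_lt_of_lt|/rank_lt_of_lt|sxa] := ltngtP (s x) (s a).
- by rewrite xa ltxx.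
- by rewrite xa ltxx.
- by apply: isolated_weight_inj => //; move: xa; rewrite /rank sxa; lra.
Qed.

Lemma rank_well_orders : well_orders_isolated rank.
Proof.
split=> [a ia|a x|b]; [|exact: rank_inj|].
  rewrite (_ : mkset _ = s @^-1` `I_(s a) `|`
      (s @^-1` [set s a] `&` [set x | isolated_pt x /\ (n x < n a)%N])).
    apply: clopenU; first exact: clopen_discrete_preimage.
    by apply: clopenI; [exact: clopen_discrete_preimage|exact: clopen_isolated_lt].
  apply/seteqP; split=> x /=; rewrite rank_ltE//.
    by case/orP=> [?|/and3P[/eqP ? /asboolP ? ?]]; [left|right].
  by case=> [->//|[-> [/asboolT-> ->]]]; rewrite eqxx orbT.
have acc_isolated k m a : isolated_pt a -> (s a < k)%N -> (n a < m)%N ->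
    Acc (fun a b => isolated_pt a /\ rank a < rank b) a.
  elim: k m a => [m a _|k IHk]; first by rewrite ltn0.
  elim=> [a _ _|m IHm a ia sak nam]; first by rewrite ltn0.
  constructor=> x [ix].
  rewrite (rank_ltE _ ia) => /orP[sxa|/and3P[/eqP sxa _ nxa]].
    by apply: (IHk (n x).+1); [|exact: leq_trans sxa _|].
  by apply: IHm; [|rewrite sxa|exact: leq_trans nxa _].
by constructor=> a [ia _]; exact: (@acc_isolated (s a).+1 (n a).+1).
Qed.

End rank.

Hypotheses (Kcpt : compact [set: K]) (Khaus : hausdorff_space K).
Hypothesis K0dim : clopen_basis K.

Lemma clopen_staircase (q : K -> R) : continuous q -> (forall x, 0 <= q x) ->
  forall k : nat, exists2 s : K -> nat, continuous s & forall x,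
    [/\ (s x <= k)%N, (s x)%:R <= q x + 1 & Num.min (q x - 1) k%:R <= (s x)%:R].
Proof.
move=> cq q0; elim=> [|k [s cs sP]].
  exists (fun=> 0%N) => x; first exact: cst_continuous.
  by rewrite addr_ge0// ge_min lexx orbT.
have [|P [clP Pge Plt]] := clopen_level Kcpt K0dim (a := k%:R) (b := k.+1%:R) cq.
  by rewrite ltr_nat.
exists (fun x => if P x then (s x).+1 else s x) => [|x].
  by apply: continuous_if_clopen => //; exact: (@continuous_discrete_comp _ _ _ S).
have [sk sle sge] := sP x; case: ifPn => [/Plt kq|/negP nP].
  have : (s x)%:R <= k%:R :> R by rewrite ler_nat.
  move: sge; rewrite !ge_min -!natr1; split => //; first by lra.
  by move: sge; case/orP; [|]; lra.
have qk : q x < k.+1%:R by rewrite ltNge; apply/negP => /Pge.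
split; [exact: leqW|by []|]; move: sge qk; rewrite !ge_min -natr1.
by case/orP => ? ?; apply/orP; left; lra.
Qed.

Lemma well_ordered_approx (q : BC R K) (e : R) : Gdelta (@accum_pts K) ->
  (forall x, 0 <= q x) -> 0 < e -> exists2 p : BC R K,
    well_orders_isolated p & forall x, `|q x - p x| <= e.
Proof.
move=> K'Gdelta q0 e0.
have /countable_injP[n n_inj] := isolated_countable Kcpt K'Gdelta.
have [m Ne] : exists m : nat, 2 <= m%:R * e.
  exists (Num.bound (2 / e)); rewrite -ler_pdivrMr//; apply: ltW.
  by apply: archi_boundP; rewrite divr_ge0// ltW.
pose N : R := m%:R; have N0 : 0 < N.
  by rewrite -(pmulr_lgt0 _ e0); apply: lt_le_trans Ne.
have N1 : 1 <= N by rewrite ler1n -(ltr_nat R).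
have cNq : continuous (fun x => N * q x).
  by move=> x; apply: cvgM; [exact: cvg_cst|exact: bc_cont].
have Nq0 x : 0 <= N * q x by rewrite mulr_ge0// ltW.
have [s cs sP] := clopen_staircase cNq Nq0 m.
pose r := rank (n := n) (s := s) : K -> R.
have rP x : `|r x| <= N /\ `|N * q x - r x| <= 2.
  have [sN s_le s_ge] := sP x; have w01 := isolated_weight_ge0_le1 (n := n) x.
  have {}sN : (s x)%:R <= N by rewrite ler_nat.
  have s0 : 0 <= (s x)%:R :> R by [].
  have {}s_ge : N * q x - 1 <= (s x)%:R.
    apply: le_trans s_ge; rewrite le_min lexx/= -/N.
    have : N * q x <= N by rewrite ger_pMr//; exact: ler_normlW (bc_le1 q x).
    by lra.
  by rewrite !ler_norml /r /rank; split; lra.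
have cp : continuous (fun x => N^-1 * r x).
  by move=> x; apply: cvgM; [exact: cvg_cst|exact: rank_continuous].
have p1 x : `|N^-1 * r x| <= 1.
  by rewrite normrM normfV (gtr0_norm N0) ler_pdivrMl// mulr1; have [] := rP x.
exists (MkBC cp p1) => [|x /=].
  apply: well_orders_isolated_scale; first by rewrite invr_gt0.
  exact: rank_well_orders.
rewrite -(ler_pM2l N0) -{1}(gtr0_norm N0) -normrM mulrBr mulVKf ?gt_eqF//.
by apply: le_trans Ne; have [] := rP x.
Qed.

End well_orders_isolated.

(** * The action on unimodular functions and on isolated points *)

Section opposed.
Context {R : realType} {K : topologicalType}.
Hypothesis Khaus : hausdorff_space K.
Implicit Types (f g : BC R K) (s x : K).

Definition opposed f g := forall y : BC R K, unimodular y ->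
  (forall x, 0 <= f x * y x) \/ (forall x, 0 <= g x * y x).

Lemma opposed_mul_lt0 f g s : opposed f g -> f s != 0 -> g s != 0 ->
  f s * g s < 0.
Proof.
move=> fg fs gs; have [y y1 yE] := unimodular_cst (K := K) (normr_sgN fs).
case: (fg y y1) => /(_ s); rewrite yE.
  by rewrite mulr_sgN oppr_ge0 normr_le0 (negPf fs).
rewrite mulrN oppr_ge0 => gf; rewrite lt_neqAle mulf_neq0//=.
by rewrite {1}[f s]numEsg mulrAC pmulr_lle0 ?normr_gt0// mulrC.
Qed.

(* A unimodular function can be prescribed independently at two distinct points,
   one of them isolated. *)
Lemma opposed_support f g s x : opposed f g -> isolated_pt s ->
  f x != 0 -> g s != 0 -> x = s.
Proof.
move=> fg is_ fx gs; apply: contrapT => /eqP/negPf xs.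
have [y y1 yE] := unimodular_cst (K := K) (normr_sgN fx).
have [y' y'1 y'E] := unimodular_update Khaus y1 is_ (normr_sgN gs).
case: (fg y' y'1) => [/(_ x)|/(_ s)]; rewrite y'E ?eqxx ?xs ?yE.
  by rewrite mulr_sgN oppr_ge0 normr_le0 (negPf fx).
by rewrite mulr_sgN oppr_ge0 normr_le0 (negPf gs).
Qed.

End opposed.

Section nonexpansive_bijection.
Context {R : realType} {K : topologicalType}.
Hypotheses (Kcpt : compact [set: K]) (Khaus : hausdorff_space K).
Hypothesis K0dim : clopen_basis K.
Hypothesis Kiso_dense : dense [set x : K | isolated_pt x].
Hypothesis K'Gdelta : Gdelta (@accum_pts K).
Context {F G : BC R K -> BC R K}.
Hypotheses (Fne : bc_non_expansive F) (FK : cancel F G) (GK : cancel G F).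
Implicit Types (f g h y : BC R K) (a b s x z : K) (c e t v : R).

Lemma bc_le_of_le_isolated f g x :
  (\forall b \near x, isolated_pt b -> f b <= g b) -> f x <= g x.
Proof. by apply: le_of_le_isolated => //; exact: bc_cont. Qed.

Lemma nonexp_le f g c : 0 <= c -> (forall x, `|f x - g x| <= c) ->
  forall x, `|F f x - F g x| <= c.
Proof.
move=> c0 fg x; apply: le_trans (supdist_ge _ _ x) _.
exact: le_trans (Fne f g) (supdist_le c0 fg).
Qed.

Lemma nonexp0 : F bc0 = bc0.
Proof.
apply: bc_ext => x; have F0w w : `|w| = 1 -> 0 <= F bc0 x * w.
  move=> w1; have [y _ yE] := unimodular_cst (K := K) w1.
  have : `|F bc0 x - F (G y) x| <= 1.
    by apply: nonexp_le => // z; rewrite sub0r normrN bc_le1.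
  by rewrite GK yE distr_normr1 ?bc_le1// gerBl.
have := F0w 1 (normr1 R); have := F0w (-1); rewrite normrN normr1.
by move=> /(_ erefl) /= ? ?; lra.
Qed.

Lemma nonexp_norm_le f c : 0 <= c -> (forall x, `|f x| <= c) ->
  forall x, `|F f x| <= c.
Proof.
move=> c0 fc x; rewrite -[F f x]subr0 -[X in _ - X]/(bc0 x) -nonexp0.
by apply: nonexp_le => // z; rewrite subr0.
Qed.

Lemma image_neq0_isolated f b : f b != 0 ->
  exists2 s, isolated_pt s & F f s != 0.
Proof.
move=> fb; apply: contrapT => nos; move: fb.
suff /(congr1 G) : F f = F bc0 by rewrite !FK => ->; rewrite eqxx.
rewrite nonexp0; apply: bc_ext => x /=; apply/eqP; rewrite -normr_le0.
apply: (@le_of_le_isolated _ Kiso_dense _ (fun z => `|F f z|) (cst 0)).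
- by apply: cvg_norm; exact: bc_cont.
- exact: cst_continuous.
- apply: nearW => s is_; rewrite /= normr_le0.
  by apply/negP => /negP Fs; apply: nos; exists s.
Qed.

Lemma midpoint_image y h : unimodular y -> (forall x, `|h x| <= 2^-1) ->
  (forall x, `|G y x - h x| <= 2^-1) -> forall x, F h x = y x / 2.
Proof.
move=> y1 h2 Gyh2 x; have half0 : 0 <= 2^-1 :> R by rewrite invr_ge0.
have := nonexp_norm_le half0 h2 x; have := nonexp_le half0 Gyh2 x.
by rewrite GK !ler_norml; have /normr_eq1[] := y1 x => ->; lra.
Qed.

(* If [`|G y b| < 1], two functions differing at [b] are midpoints of [0] and
   [G y], while [y / 2] is the only midpoint of [0] and [y]. *)
Lemma unimodular_preimage y : unimodular y -> unimodular (G y).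
Proof.
move=> y1; set f := G y.
have half1 : `|2^-1 : R| <= 1 by rewrite ger0_norm; lra.
have f_isolated b : isolated_pt b -> 1 <= `|f b|.
  move=> ib; pose t := f b / 2 + (1 - `|f b|) / 2.
  have [t2 ft2] : `|t| <= 2^-1 /\ `|f b - t| <= 2^-1.
    by rewrite /t !ler_norml; have := bc_le1 f b; case: (ger0P (f b)); lra.
  have t1 : `|t| <= 1 by lra.
  pose h := bc_mul f (bc_cst half1); pose h' := bc_update Khaus ib t1 h.
  have hP x : `|h x| <= 2^-1 /\ `|f x - h x| <= 2^-1.
    by rewrite /= !ler_norml; have := bc_ge_le f x; lra.
  have h'P x : `|h' x| <= 2^-1 /\ `|f x - h' x| <= 2^-1.
    by rewrite /= /bc_cst; case: eqP => [->|_]; [|exact: hP].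
  have /(congr1 G) : F h = F h'.
    apply: bc_ext => x.
    rewrite (midpoint_image y1 (fun x => (hP x).1) (fun x => (hP x).2)).
    by rewrite (midpoint_image y1 (fun x => (h'P x).1) (fun x => (h'P x).2)).
  rewrite !FK => /(congr1 (fun k : BC R K => k b)) /=.
  by rewrite eqxx /t; lra.
move=> x; apply/le_anti; rewrite bc_le1 /=.
apply: (@le_of_le_isolated _ Kiso_dense _ (cst 1) (fun z => `|f z|)).
- exact: cst_continuous.
- by apply: cvg_norm; exact: bc_cont.
- by apply: nearW => b /f_isolated.
Qed.

Lemma mul_image_ge f y c : unimodular y -> c <= 1 ->
  (forall x, c <= f x * G y x) -> forall x, c <= F f x * y x.
Proof.
move=> y1 c1 fGy x; rewrite -(lerD2l (- F f x * y x)).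
have : `|F f x - F (G y) x| <= 1 - c.
  apply: nonexp_le; rewrite ?subr_ge0// => z.
  by rewrite distr_normr1 ?lerD2l ?lerN2// ?bc_le1//; exact: unimodular_preimage.
by rewrite GK distr_normr1 ?bc_le1//; lra.
Qed.

Lemma opposed_spike_images b t t' f f' : is_spike b t f -> is_spike b t' f' ->
  t * t' < 0 -> opposed (F f) (F f').
Proof.
move=> fE f'E tt' y y1.
have spike_image r g : is_spike b r g -> 0 <= r * G y b ->
    forall x, 0 <= F g x * y x.
  move=> gE rG; apply: mul_image_ge => // x.
  by rewrite gE; case: eqP => [->//|_]; rewrite mul0r.
have [tG|tG] := leP 0 (t * G y b); first by left; exact: spike_image tG.
by right; apply: (spike_image t') => //; have := unimodular_preimage y1 b; nra.
Qed.

Definition maps_spikes b s e := forall t f, t != 0 -> is_spike b t f ->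
  exists2 v, 0 < e * t * v & is_spike s v (F f).

Definition orients_unit_spikes b s e := forall w f, `|w| = 1 ->
  is_spike b w f -> 0 < e * w * F f s.

Lemma spike_image_neq0 b t f : is_spike b t f -> t != 0 ->
  exists2 s, isolated_pt s & F f s != 0.
Proof. by move=> fE t0; apply: (image_neq0_isolated (b := b)); rewrite fE eqxx. Qed.

Lemma isolated_image b : isolated_pt b -> exists s e,
  [/\ isolated_pt s, `|e| = 1 & orients_unit_spikes b s e].
Proof.
move=> ib; have [p pE] := unit_spike_exists Khaus ib (normr1 R).
have [m mE] := unit_spike_exists Khaus ib (normrN1 R).
have [s is_ ps] := spike_image_neq0 pE (oner_neq0 R).
have [s' _ ms'] : exists2 s, isolated_pt s & F m s != 0.
  by apply: spike_image_neq0 mE _; rewrite oppr_eq0 oner_eq0.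
have mp : opposed (F m) (F p) by apply: opposed_spike_images mE pE _; lra.
have ss' := opposed_support Khaus mp is_ ms' ps; rewrite {}ss' in ms'.
have mp0 := opposed_mul_lt0 mp ms' ps.
have ep : 0 < Num.sg (F p s) * F p s by rewrite -normrEsg normr_gt0.
exists s, (Num.sg (F p s)); split=> [//||w f]; first by rewrite normr_sg ps.
case/normr_eq1 => -> fE.
  by rewrite mulr1 (_ : f = p)//; apply: bc_ext => x; rewrite fE pE.
rewrite (_ : f = m); last by apply: bc_ext => x; rewrite fE mE.
by rewrite mulrN1 mulNr oppr_gt0; exact: mulr_lt0_of_signs ep mp0.
Qed.

Lemma orients_unit_spikes_maps_spikes b s e : isolated_pt b -> isolated_pt s ->
  orients_unit_spikes b s e -> maps_spikes b s e.
Proof.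
move=> ib is_ eF t f t0 fE.
have [f' f'E] := unit_spike_exists Khaus ib (normr_sgN t0).
have ef' := eF _ _ (normr_sgN t0) f'E.
have f's : F f' s != 0 by apply: contraTneq ef' => ->; rewrite mulr0 ltxx.
have ff' : opposed (F f) (F f').
  by apply: opposed_spike_images fE f'E _; rewrite mulr_sgN oppr_lt0 normr_gt0.
have supp x : F f x != 0 -> x = s by move=> fx; exact: opposed_support fx f's.
have [z _ fz] := spike_image_neq0 fE t0.
have fs : F f s != 0 by rewrite -(supp _ fz).
exists (F f s); last first.
  move=> x; case: eqP => [->//|/eqP xs]; apply/eqP; apply: contraNT xs.
  by move=> /supp ->.
have := mulr_lt0_of_signs ef' (opposed_mul_lt0 ff' fs f's).
rewrite mulrN mulNr oppr_lt0 {2}[t]numEsg => tf.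
by rewrite mulrA mulrAC mulr_gt0 ?normr_gt0.
Qed.

Lemma orients_unit_spikes_preimage b s e y : isolated_pt b -> `|e| = 1 ->
  orients_unit_spikes b s e -> unimodular y -> G y b = e * y s.
Proof.
move=> ib e1 eF y1; have w1 := unimodular_preimage y1 b.
have [f fE] := unit_spike_exists Khaus ib w1.
have Fy : 0 <= F f s * y s.
  apply: (mul_image_ge y1) => // x; rewrite fE.
  by case: eqP => [->|_]; rewrite ?normr1_sqr ?mul0r.
apply: normr1_mul_eq; rewrite ?normrM ?e1 ?y1 ?mulr1//.
move: Fy (eF _ _ w1 fE).
by case/normr_eq1: w1 => ->; case/normr_eq1: e1 => ->;
  case/normr_eq1: (y1 s) => ->; lra.
Qed.

(* [sin] serves as a continuous surjection of [0, pi/2] onto [0, 1]. *)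
Lemma image_segment f s v : 0 <= v <= F f s ->
  exists t g, (forall x, g x = t * f x) /\ F g s = v.
Proof.
move=> vF; have sin1 t : `|sin t| <= 1 by rewrite ler_norml sin_geN1 sin_le1.
pose scaled t := bc_mul (bc_cst (sin1 t)) f; pose phi t := F (scaled t) s.
have phi_lip t u : `|phi t - phi u| <= `|sin t - sin u|.
  apply: nonexp_le => // x; rewrite -mulrBl normrM ler_piMr//; exact: bc_le1.
have cphi : continuous phi.
  move=> t; apply/cvgrPdist_lt => e e0.
  have /cvgrPdist_lt/(_ e e0) := @continuous_sin R t.
  by apply: filterS => u; apply: le_lt_trans.
have phi0 : phi 0 = 0.
  rewrite /phi (_ : scaled 0 = bc0) ?nonexp0//.
  by apply: bc_ext => x; rewrite /= sin0 mul0r.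
have phi1 : phi (pi / 2) = F f s.
  rewrite /phi (_ : scaled _ = f)//.
  by apply: bc_ext => x; rewrite /= sin_pihalf mul1r.
have pi2 : 0 <= pi / 2 :> R by rewrite divr_ge0// pi_ge0.
have [|t _ phit] := @IVT R phi 0 (pi / 2) v pi2 (continuous_subspaceT cphi).
  by rewrite phi0 phi1; case/andP: vF => v0 vF; rewrite ge_min le_max v0 vF orbT.
by exists (sin t), (scaled t).
Qed.

(* Otherwise the images of the segments through [b] and [b'] would overlap. *)
Lemma maps_spikes_inj b b' s e e' : isolated_pt b -> isolated_pt b' ->
  `|e| = 1 -> `|e'| = 1 -> maps_spikes b s e -> maps_spikes b' s e' -> b = b'.
Proof.
move=> ib ib' e1 e'1 be b'e'.
have [p pE] := unit_spike_exists Khaus ib e1.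
have [p' p'E] := unit_spike_exists Khaus ib' e'1.
have [v v0 Fp] := be _ _ (normr1_neq0 e1) pE.
have [v' v'0 Fp'] := b'e' _ _ (normr1_neq0 e'1) p'E.
rewrite normr1_sqr// mul1r in v0; rewrite normr1_sqr// mul1r in v'0.
wlog vv' : b b' e e' ib ib' e1 e'1 be b'e' p pE p' p'E v v0 Fp v' v'0 Fp' / v' <= v.
  move=> W; have [|/ltW] := leP v' v; first exact: W pE _ p'E _ _ Fp _ _ Fp'.
  by move=> v'v; apply/esym; exact: (W _ _ _ _ ib' ib) p'E _ pE _ _ Fp' _ _ Fp _.
have [|t [g [gE gs]]] := @image_segment p s v'; first by rewrite Fp eqxx (ltW v'0).
have g_spike : is_spike b (t * e) g.
  by move=> x; rewrite gE pE; case: ifP; rewrite ?mulr0.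
have te0 : t * e != 0.
  apply: contraTneq v'0 => te0; rewrite -gs (_ : g = bc0) ?nonexp0 ?ltxx//.
  by apply: bc_ext => x; rewrite g_spike te0 if_same.
have [u _ Fg] := be _ _ te0 g_spike.
have uv' : u = v' by rewrite -gs Fg eqxx.
have /(congr1 G) : F g = F p' by apply: bc_ext => x; rewrite Fg Fp' uv'.
rewrite !FK => /(congr1 (fun k : BC R K => k b')).
rewrite g_spike p'E eqxx; case: eqP => [->//|_ /esym/eqP].
by rewrite (negPf (normr1_neq0 e'1)).
Qed.

(** * The representation of G on unimodular functions *)

Definition phase := G bc1.

Lemma phase_unimodular : unimodular phase.
Proof. exact: unimodular_preimage bc1_unimodular. Qed.

Lemma phase_mulK x (c : R) : phase x * (phase x * c) = c.
Proof. by rewrite mulrA normr1_sqr ?mul1r ?phase_unimodular. Qed.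

Definition pulls_back_along x z :=
  forall y, unimodular y -> G y x = phase x * y z.

Lemma pulls_back_along_unique x z z' :
  pulls_back_along x z -> pulls_back_along x z' -> z = z'.
Proof.
move=> xz xz'; apply: contrapT => zz'.
have oz' : open (~` [set z']).
  by apply/closed_openC/accessible_closed_set1/hausdorff_accessible.
have [y y1 yz] := unimodular_separating (R := R) K0dim oz' zz'.
apply: (yz z') => //; suff -> : y z' = y z by rewrite normr1_sqr// y1.
by rewrite -[LHS](phase_mulK x) -xz'// xz// phase_mulK.
Qed.

Lemma isolated_pulls_back_along b : isolated_pt b -> exists s,
  [/\ isolated_pt s, maps_spikes b s (phase b) & pulls_back_along b s].
Proof.
move=> ib; have [s [e [is_ e1 eF]]] := isolated_image ib; exists s.
have phaseE : phase b = e.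
  rewrite /phase (orients_unit_spikes_preimage ib e1 eF) ?mulr1//.
  exact: bc1_unimodular.
split=> // [|y y1]; rewrite phaseE.
  exact: orients_unit_spikes_maps_spikes.
exact: orients_unit_spikes_preimage.
Qed.

Lemma pulls_back_along_exists x : exists z, pulls_back_along x z.
Proof.
have /choice[tau tauP] b : exists s, isolated_pt b -> pulls_back_along b s.
  have [/isolated_pulls_back_along[s [_ _ bs]]|nb] := pselect (isolated_pt b).
    by exists s.
  by exists b.
have Pw := within_isolated_proper Kiso_dense x.
have [z [_ zclust]] := Kcpt (fmap_proper_filter tau Pw) filterT.
exists z => y y1.
have near_tau : \forall s \near tau @ within [set b | isolated_pt b] (nbhs x),
    G y x = phase x * y s.
  have := unimodular_near x phase_unimodular.
  have := unimodular_near x (unimodular_preimage y1).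
  by apply: filterS2 => b yb eb ib; rewrite -yb -eb (tauP b).
by have [s [/= -> ->]] := zclust _ _ near_tau (unimodular_near z y1).
Qed.

Definition point_map x := xget x (pulls_back_along x).

Lemma preimage_unimodular y x : unimodular y -> G y x = phase x * y (point_map x).
Proof. by apply: (xgetPex x (pulls_back_along_exists x)). Qed.

Lemma point_map_unique x z : pulls_back_along x z -> point_map x = z.
Proof.
move=> xz; apply: pulls_back_along_unique xz => y; exact: preimage_unimodular.
Qed.

Lemma phase_preimage y x : unimodular y -> phase x * G y x = y (point_map x).
Proof. by move=> y1; rewrite preimage_unimodular// phase_mulK. Qed.

Lemma point_map_continuous : continuous point_map.
Proof.
move=> x A; rewrite nbhsE => -[U [oU Ux] UA].
have [y y1 yU] := unimodular_separating (R := R) K0dim oU Ux.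
have := unimodular_near x phase_unimodular.
have := unimodular_near x (unimodular_preimage y1).
rewrite /fmap /=; apply: filterS2 => z yz ez; apply/UA/yU.
by rewrite -!phase_preimage// yz ez normr1_sqr// normrM phase_unimodular
  (unimodular_preimage y1) mulr1.
Qed.

Lemma point_map_isolated b : isolated_pt b -> isolated_pt (point_map b).
Proof.
move=> /isolated_pulls_back_along[s [is_ _ bs]].
by rewrite (point_map_unique bs).
Qed.

Lemma point_map_spikes b : isolated_pt b -> maps_spikes b (point_map b) (phase b).
Proof.
move=> /isolated_pulls_back_along[s [_ spikes bs]].
by rewrite (point_map_unique bs).
Qed.

Lemma point_map_inj_isolated b x : isolated_pt b ->
  point_map x = point_map b -> x = b.
Proof.
move=> ib xb; apply: contrapT => x_neq_b.
have n1 : nbhs x (point_map @^-1` [set point_map b]).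
  by apply: point_map_continuous; rewrite xb; exact: point_map_isolated.
have n2 : nbhs x (~` [set b]).
  apply: open_nbhs_nbhs; split => //; apply: closed_openC.
  by have [] := isolated_clopen Khaus ib.
have [c ic [/= cb c_neq_b]] := isolated_near Kiso_dense (filterI n1 n2).
apply: c_neq_b.
apply: (@maps_spikes_inj c b (point_map b) (phase c) (phase b)) => //.
- exact: phase_unimodular.
- exact: phase_unimodular.
- by rewrite -cb; exact: point_map_spikes.
- exact: point_map_spikes.
Qed.

Lemma closed_image_point_map (A : set K) : closed A -> closed (point_map @` A).
Proof.
move=> cA; apply: (compact_closed Khaus); apply: continuous_compact.
  exact: continuous_subspaceT point_map_continuous.
exact: subclosed_compact cA Kcpt _.
Qed.

Lemma point_map_surjective z : exists x, point_map x = z.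
Proof.
have hits_isolated b : isolated_pt b -> exists x, point_map x = b.
  move=> ib; apply: contrapT => nb.
  have [y y1 yE] := unimodular_update Khaus bc1_unimodular ib (normrN1 R).
  have /(congr1 F) : G y = phase.
    apply: bc_ext => x; rewrite preimage_unimodular// yE; case: eqP => [xb|_].
      by exfalso; apply: nb; exists x.
    by rewrite mulr1.
  by rewrite !GK => /(congr1 (fun k : BC R K => k b)); rewrite yE eqxx /=; lra.
apply: contrapT => nz; have : nbhs z (~` (point_map @` setT)).
  apply: open_nbhs_nbhs; split.
    by apply: closed_openC; exact: closed_image_point_map closedT.
  by move=> [x _ xz]; apply: nz; exists x.
move=> /(isolated_near Kiso_dense)[b /hits_isolated[x <-]]; apply.
by exists x.
Qed.

(** * Lifting along the point map *)

Definition lift h := bc_mul phase (bc_comp point_map_continuous h).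

Lemma lift_dist h k x :
  `|lift h x - lift k x| = `|h (point_map x) - k (point_map x)|.
Proof. by rewrite /= -mulrBr normrM phase_unimodular mul1r. Qed.

Lemma lift_mul_preimage h y x : unimodular y ->
  lift h x * G y x = h (point_map x) * y (point_map x).
Proof.
move=> y1; rewrite preimage_unimodular//= mulrACA.
by rewrite normr1_sqr ?mul1r ?phase_unimodular.
Qed.

Lemma supdist_lift_le h k : supdist (lift h) (lift k) <= supdist h k.
Proof.
by apply: supdist_le => [|x]; [exact: supdist_ge0|rewrite lift_dist supdist_ge].
Qed.

Definition lift_surjective := forall f, exists h, lift h = f.

Definition lift_fixed h := F (lift h) = h.

Lemma lift_fixed_closed g :
  (forall c, 0 < c -> exists2 h, lift_fixed h & forall x, `|g x - h x| <= c) ->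
  lift_fixed g.
Proof.
move=> approx; apply: bc_ext => x; apply/eqP.
rewrite -subr_eq0 -normr_le0; apply/ler_addgt0Pr => c c0; rewrite add0r.
have c20 : 0 < c / 2 by rewrite divr_gt0.
have [h hfix gh] := approx _ c20.
have : `|F (lift g) x - F (lift h) x| <= c / 2.
  by apply: nonexp_le (ltW c20) _ _ => z; rewrite lift_dist.
by have := gh x; rewrite hfix !ler_norml; lra.
Qed.

Lemma lift_fixed_dist f k y s : lift_fixed k -> unimodular y -> exists x,
  `|F f s * y s - k s * y s| <=
  `|f x * G y x - k (point_map x) * y (point_map x)|.
Proof.
move=> kfix y1; have [x xE] := supdist_attained f (lift k) s Kcpt; exists x.
rewrite -lift_mul_preimage// !distr_mulr1 ?y1//; last exact: unimodular_preimage.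
by rewrite -xE -{1}kfix; apply: le_trans (supdist_ge _ _ _) (Fne _ _).
Qed.

(** * Functions fixed above a detection threshold *)

(* Condition (ii) gives this for some [d < 1], surjectivity of [lift] for
   [d = 0]. *)
Definition sign_detecting d := forall f b, isolated_pt b ->
  d < `|F f (point_map b)| -> 0 < f b * phase b * F f (point_map b).

Section above_threshold.
Context {d : R}.
Hypotheses (d0 : 0 <= d) (detecting : sign_detecting d).

Lemma detected_preimage_ge0 f y : unimodular y -> (forall x, d < F f x * y x) ->
  forall x, 0 <= f x * G y x.
Proof.
move=> y1 dFy x.
apply: (@bc_le_of_le_isolated bc0 (bc_mul f (G y))).
apply: nearW => b ib /=; set s := point_map b; apply: ltW.
have Fy : 0 < F f s * y s by exact: le_lt_trans d0 (dFy s).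
have fF : 0 < f b * phase b * F f s.
  apply: detecting => //; apply: (lt_le_trans (dFy s)).
  by rewrite -[leRHS]mulr1 -(y1 s) -normrM ler_norm.
rewrite preimage_unimodular// mulrA; apply: mulr_gt0_of_signs fF _.
by rewrite mulrC.
Qed.

(* Compare [f] with the preimage of [y] flipped at [point_map b] only. *)
Lemma detected_le_preimage f y : unimodular y -> (forall x, d < F f x * y x) ->
  forall x, F f (point_map x) * y (point_map x) <= f x * G y x.
Proof.
move=> y1 dFy x.
have fGy0 := detected_preimage_ge0 y1 dFy.
apply: (@bc_le_of_le_isolated (bc_comp point_map_continuous (bc_mul (F f) y))
  (bc_mul f (G y))).
apply: nearW => b ib /=; set s := point_map b.
have ys1 : `|- y s| = 1 by rewrite normrN.
have [y' y'1 y'E] := unimodular_update Khaus y1 (point_map_isolated ib) ys1.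
have := @mul_image_ge f y' (- (f b * G y b)) y'1 _ _ s.
rewrite y'E eqxx mulrN lerN2; apply=> [|z].
  by rewrite (le_trans _ ler01)// oppr_le0.
rewrite (preimage_unimodular z y'1) y'E.
case: eqP => [/(point_map_inj_isolated ib)->|_].
  by rewrite preimage_unimodular// !mulrN.
by rewrite -preimage_unimodular// (le_trans _ (fGy0 z))// oppr_le0.
Qed.

Lemma lift_fixed_of_preimage_le h y : unimodular y ->
  (forall x, d < h x * y x) -> (forall b, isolated_pt b ->
    G h b * G y b <= h (point_map b) * y (point_map b)) -> lift_fixed h.
Proof.
move=> y1 dhy Gh_le; rewrite /lift_fixed -[RHS]GK; congr F; apply: bc_ext => x.
apply: (mulIf (normr1_neq0 (unimodular_preimage y1 x))).
rewrite lift_mul_preimage//; apply/le_anti/andP; split.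
  by rewrite -{1}(GK h) detected_le_preimage// GK.
apply: (@bc_le_of_le_isolated (bc_mul (G h) (G y))
  (bc_comp point_map_continuous (bc_mul h y))).
exact: nearW.
Qed.

Section well_ordered.
Context {y p : BC R K}.
Hypotheses (y1 : unimodular y) (dp : forall x, d < p x).
Hypothesis p_well_orders : well_orders_isolated p.

(* The sets [p < p a] are the proper initial segments of a well-order on the
   isolated points; a truncation agrees with [y * p] on such a segment and with
   [y] elsewhere, and is shown to be fixed by induction along the order. *)
Definition is_truncation t h :=
  forall x, h x * y x = if p x < t then p x else 1.

Lemma truncation_exists t : clopen [set x | p x < t] ->
  exists h, is_truncation t h.
Proof.
move=> clt; exists (bc_if clt (bc_mul y p) y) => x /=.
by case: ifP => _; rewrite ?normr1_sqr// mulrAC normr1_sqr ?mul1r.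
Qed.

Lemma truncation_gt t h x : is_truncation t h -> d < h x * y x.
Proof.
move=> ->; case: ifP => _ //; apply: lt_le_trans (dp x) _.
exact: ler_normlW (bc_le1 p x).
Qed.

Lemma truncation_preimage_le t h : is_truncation t h ->
  (forall a k, isolated_pt a -> p a < t -> is_truncation (p a) k -> lift_fixed k) ->
  forall b, isolated_pt b ->
    G h b * G y b <= h (point_map b) * y (point_map b).
Proof.
move=> hE IH; have [p_clopen p_inj p_wf] := p_well_orders.
suff le_at s b : isolated_pt b -> point_map b = s -> G h b * G y b <= h s * y s.
  by move=> b ib; exact: le_at.
have le1 x : G h x * G y x <= 1.
  exact: ler_normlW (bc_le1 (bc_mul (G h) (G y)) x).
have hy_le x : h (point_map x) * y (point_map x) <= G h x * G y x.
  rewrite -{1}(GK h) detected_le_preimage// => z; rewrite GK.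
  exact: truncation_gt hE.
elim/(well_founded_ind p_wf): s b => s IHs b ib bs.
have is_ : isolated_pt s by rewrite -bs; exact: point_map_isolated.
rewrite hE; case: ifPn => // pst.
have [p_ge1|p_lt1] := leP 1 (p s); first exact: le_trans (le1 b) p_ge1.
have hyE x : p (point_map x) < p s ->
    h (point_map x) * y (point_map x) = p (point_map x).
  by move=> px; rewrite hE (lt_trans px pst).
have [k kE] := truncation_exists (p_clopen _ is_).
have [x] := lift_fixed_dist (G h) s (IH _ _ is_ pst kE) y1.
rewrite GK hE pst !kE ltxx distrC ger0_norm; last by lra.
case: ifPn => [px|px xdist].
  have -> : G h x * G y x = p (point_map x); last by rewrite subrr normr0; lra.
  apply/le_anti/andP; split; last by rewrite -hyE.
  apply: (@bc_le_of_le_isolated (bc_mul (G h) (G y))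
    (bc_comp point_map_continuous p)).
  have cpx : p (point_map z) @[z --> x] --> p (point_map x).
    exact: (@bc_cont _ _ (bc_comp point_map_continuous p)).
  have : \forall z \near x, p (point_map z) < p s by exact: (cvgr_lt _ cpx).
  apply: filterS => z pz iz; rewrite /= -hyE//.
  by apply: IHs => //; split=> //; exact: point_map_isolated.
have x_le : G h x * G y x <= p s.
  by move: xdist; rewrite distrC ger0_norm ?subr_ge0//; lra.
have := le_trans (hy_le x) x_le; rewrite hE; case: ifPn => [_ p_le|_]; last by lra.
suff -> : b = x by [].
apply/esym/point_map_inj_isolated => //; rewrite bs; apply: p_inj => //.
by apply/le_anti; rewrite p_le leNgt.
Qed.

Lemma truncation_fixed_step t h : is_truncation t h ->
  (forall a k, isolated_pt a -> p a < t -> is_truncation (p a) k -> lift_fixed k) ->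
  lift_fixed h.
Proof.
move=> hE IH; apply: (lift_fixed_of_preimage_le y1).
  by move=> x; exact: truncation_gt hE.
exact: truncation_preimage_le hE IH.
Qed.

Lemma well_ordered_fixed h : (forall x, h x * y x = p x) -> lift_fixed h.
Proof.
move=> hE; have [_ _ p_wf] := p_well_orders.
apply: (@truncation_fixed_step 2) => [x|a k ia _].
  by rewrite hE (le_lt_trans _ (ltr1n R 2))//; exact: ler_normlW (bc_le1 p x).
elim/(well_founded_ind p_wf): a => a IH in ia k * => kE.
by apply: truncation_fixed_step kE _ => c l ic ca; exact: IH.
Qed.

End well_ordered.

Lemma fixed_above_threshold h y c : unimodular y -> d < c ->
  (forall x, c <= h x * y x) -> lift_fixed h.
Proof.
move=> y1 dc c_le; apply: lift_fixed_closed => e e0.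
have e'0 : 0 < Num.min e ((c - d) / 2) by rewrite lt_min e0 divr_gt0// subr_gt0.
have hy0 x : 0 <= bc_mul h y x.
  exact: le_trans (le_trans d0 (ltW dc)) (c_le x).
have [p p_wo hyp] := well_ordered_approx Kcpt Khaus K0dim K'Gdelta hy0 e'0.
have p_close x : `|h x * y x - p x| <= e /\ d < p x.
  have := hyp x; rewrite le_min /= => /andP[-> ]; rewrite ler_norml => hyp_x.
  by split=> //; have := c_le x; lra.
exists (bc_mul p y) => [|x].
  apply: (well_ordered_fixed y1 (p := p)) => [x||x] //=.
    by have [] := p_close x.
  by rewrite -mulrA normr1_sqr ?mulr1.
rewrite -(distr_mulr1 _ _ (y1 x)) /= -mulrA normr1_sqr// mulr1.
by have [] := p_close x.
Qed.

(* [g] is at distance at most [r] from both [g + r] and [g - r], which are fixed. *)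
Lemma small_fixed g : d < 1 -> (forall x, `|g x| <= (1 - d) / 4) -> lift_fixed g.
Proof.
move=> d1 g_small; have d_ge0 := d0; apply: bc_ext => x.
pose r := (1 + d) / 2.
have shift w : `|w| = 1 -> `|F (lift g) x - (g x + w * r)| <= r.
  move=> w1; have gw z : `|g z * w| <= (1 - d) / 4 by rewrite normrM w1 mulr1.
  have ch : continuous (fun z => g z + w * r).
    by move=> z; apply: cvgD; [exact: bc_cont|exact: cvg_cst].
  have gwE z : (g z + w * r) * w = g z * w + r.
    by rewrite mulrDl mulrAC normr1_sqr// mul1r.
  have h1 z : `|g z + w * r| <= 1.
    rewrite -[leLHS]mulr1 -{1}w1 -normrM gwE.
    by have := gw z; rewrite !ler_norml /r; lra.
  pose h := MkBC ch h1; have [y y1 yE] := unimodular_cst (K := K) w1.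
  have hfix : lift_fixed h.
    apply: (@fixed_above_threshold h y ((1 + 3 * d) / 4) y1) => [|z]; first by lra.
    by rewrite yE /= gwE; have := gw z; rewrite ler_norml /r; lra.
  rewrite -[g x + w * r]/(h x) -hfix.
  have r0 : 0 <= r by rewrite /r; lra.
  apply: nonexp_le => // z; rewrite lift_dist /= opprD addNKr normrN.
  by rewrite normrM w1 mul1r ger0_norm.
have := shift 1 (normr1 R); have := shift (-1) (normrN1 R).
by rewrite !ler_norml; lra.
Qed.

Lemma lift_surjective_of_detecting : d < 1 -> lift_surjective.
Proof.
move=> d1 f; pose t := (1 - d) / 4.
have t0 : 0 < t by rewrite /t; lra.
have t1 : `|t| <= 1 by rewrite gtr0_norm// /t; have := d0; lra.
pose tf := bc_mul f (bc_cst t1).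
have Ftf x : `|F tf x| <= t.
  apply: nonexp_norm_le; first exact: ltW.
  by move=> z; rewrite normrM (gtr0_norm t0) ler_piMl ?bc_le1// ltW.
have /(congr1 G) := small_fixed d1 Ftf; rewrite !FK => lift_Ftf.
have ch : continuous (fun x => F tf x / t).
  by move=> x; apply: cvgM; [exact: bc_cont|exact: cvg_cst].
have h1 x : `|F tf x / t| <= 1.
  by rewrite normrM normfV (gtr0_norm t0) ler_pdivrMr// mul1r.
exists (MkBC ch h1); apply: bc_ext => x.
have := congr1 (fun k : BC R K => k x) lift_Ftf.
by rewrite /= mulrA => ->; rewrite mulfK// gt_eqF.
Qed.

End above_threshold.

Lemma sign_detecting0_of_lift_surjective : lift_surjective -> sign_detecting 0.
Proof.
move=> lift_surj f b ib; have [h <-] := lift_surj f; set s := point_map b.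
rewrite normr_gt0 => Fs.
have -> : lift h b * phase b = h s by rewrite /= mulrC phase_mulK.
rewrite ltNge; apply/negP => hF; set u := F (lift h) s in Fs hF.
have u0 : 0 < `|u| by rewrite normr_gt0.
have [|y y1 hy] := unimodular_almost_aligned Kcpt K0dim h (c := `|u| / 2).
  by rewrite divr_gt0.
have [y' y'1 y'E] :=
  unimodular_update Khaus y1 (point_map_isolated ib) (normr_sgN Fs).
have hy' x : - (`|u| / 2) <= lift h x * G y' x.
  rewrite lift_mul_preimage// y'E; case: eqP => [->|_]; last exact: hy.
  by rewrite mulrN lerN2 -(ler_pM2r u0) -mulrA mulr_sg_norm (le_trans hF).
have u_le1 : - (`|u| / 2) <= 1 by lra.
by have := mul_image_ge y'1 u_le1 hy' s; rewrite y'E eqxx mulr_sgN -/u; lra.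
Qed.

Lemma lift_fixed_of_detecting0 : sign_detecting 0 -> forall g, lift_fixed g.
Proof.
move=> detecting g; apply: lift_fixed_closed => c c0.
have e01 : 0 < Num.min (c / 2) 1 <= 1.
  by rewrite lt_min ge_min lexx orbT ltr01 divr_gt0.
have [y [h [y1 gh hy]]] := nonvanishing_approx Kcpt K0dim g e01.
exists h.
  by apply: (fixed_above_threshold (lexx 0) detecting y1 _ hy); case/andP: e01.
move=> x; apply: (le_trans (gh x)); rewrite mulrC -ler_pdivlMr//.
by rewrite ge_min lexx.
Qed.

Lemma isometry_of_lift_surjective : lift_surjective -> bc_isometry F.
Proof.
move=> /sign_detecting0_of_lift_surjective/lift_fixed_of_detecting0 fixed f g.
have liftF k : lift (F k) = k by have /(congr1 G) := fixed (F k); rewrite !FK.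
apply/le_anti; rewrite Fne /= -{1}(liftF f) -{1}(liftF g).
exact: supdist_lift_le.
Qed.

(** * The two sufficient conditions *)

Lemma undetected_spike f b : isolated_pt b -> F f (point_map b) != 0 ->
  f b * phase b * F f (point_map b) <= 0 -> exists w g v,
  [/\ `|w| = 1, is_spike b w g, is_spike (point_map b) v (F g), v != 0 &
      `|F f (point_map b)| + `|v| <= 1].
Proof.
move=> ib; set u := F f (point_map b) => u0 fu.
pose w := - Num.sg u * phase b.
have w1 : `|w| = 1 by rewrite normrM normr_sgN// phase_unimodular mulr1.
have [g gE] := unit_spike_exists Khaus ib w1.
have [v wv Fg] := point_map_spikes ib (normr1_neq0 w1) gE.
have {}wv : Num.sg u * v < 0.
  move: wv; rewrite /w mulrCA normr1_sqr ?phase_unimodular//.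
  by rewrite mulr1 mulNr oppr_gt0.
have v0 : v != 0 by apply: contraTneq wv => ->; rewrite mulr0 ltxx.
exists w, g, v; split=> //.
have fw : 0 <= f b * w.
  rewrite /w mulrCA mulNr oppr_ge0 -(pmulr_lle0 _ (_ : 0 < `|u|)) ?normr_gt0//.
  by rewrite mulrAC mulr_sg_norm mulrC.
have uv : `|u - v| <= 1.
  rewrite -[v](_ : F g (point_map b) = _); last by rewrite Fg eqxx.
  apply: nonexp_le => // x; rewrite gE; case: eqP => [->|_].
    by rewrite distr_normr1// ?bc_le1// gerBl.
  by rewrite subr0 bc_le1.
apply: le_trans uv.
have -> : `|v| = - (Num.sg u * v).
  by rewrite -(ltr0_norm wv) normrM normr_sg u0 mul1r.
by rewrite normrEsg -mulrBr (le_trans (ler_norm _))// normrM normr_sg u0 mul1r.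
Qed.

Lemma lift_surjective_of_cond_ii : cond_ii F -> lift_surjective.
Proof.
move=> [c c_gt spikes_ge].
apply: (@lift_surjective_of_detecting (Num.max 0 (1 - c))).
- by rewrite le_max lexx.
- move=> f b ib; rewrite gt_max => /andP[u0 uc]; rewrite ltNge; apply/negP => fu.
  have [|w [g [v [w1 gE Fg _ uv]]]] := undetected_spike ib _ fu.
    by rewrite -normr_gt0.
  have := spikes_ge b w g ib ((normr_eq1 w).1 w1) gE.
  by rewrite (supnorm_spike Fg); lra.
- by rewrite gt_max ltr01 /=; lra.
Qed.

Lemma phase_sign_at_norming_point f x z : point_map x = z ->
  (\forall s \near z, `|F f s| = 1) -> 0 <= f x * phase x * F f z.
Proof.
move=> <- Ff1; apply: (@bc_le_of_le_isolated bc0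
  (bc_mul (bc_mul f phase) (bc_comp point_map_continuous (F f)))).
have : \forall b \near x, `|F f (point_map b)| = 1.
  exact: (@point_map_continuous x [set s | `|F f s| = 1]).
apply: filterS => b Ff1b ib /=; rewrite leNgt; apply/negP => /ltW fF.
have [|w [g [v [_ _ _ v0]]]] := undetected_spike ib _ fF.
  exact: normr1_neq0.
by rewrite Ff1b gerDl normr_le0 (negPf v0).
Qed.

Lemma point_map_injective_of_property_star : property_star F -> injective point_map.
Proof.
move=> star u v uv; apply: contrapT => u_neq_v.
have phase1 : `|- (phase u * phase v)| = 1.
  by rewrite normrN normrM !phase_unimodular mulr1.
have [f [fw Ff1]] := star u v (point_map u) _ u_neq_v ((normr_eq1 _).1 phase1).
have Fu := phase_sign_at_norming_point erefl Ff1.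
have Fv := phase_sign_at_norming_point (esym uv) Ff1.
have := mulr_ge0 Fu Fv; rewrite mulrACA normr1_sqr ?(nbhs_singleton Ff1)// mulr1.
by rewrite mulrACA mulrC; lra.
Qed.

Lemma lift_surjective_of_injective : injective point_map -> lift_surjective.
Proof.
move=> inj f; have /choice[tau tauK] := point_map_surjective.
have tau_cont : continuous tau.
  apply/continuous_closedP => A /closed_image_point_map; congr closed.
  apply/seteqP; split=> [_ [x Ax <-]|z Az]; last by exists (tau z).
  by rewrite /preimage /= (inj (tau _) x).
exists (bc_comp tau_cont (bc_mul phase f)); apply: bc_ext => x /=.
by rewrite (inj (tau _) x)// phase_mulK.
Qed.

Lemma isometry_of_cond_ii : cond_ii F -> bc_isometry F.
Proof.
by move=> /lift_surjective_of_cond_ii; exact: isometry_of_lift_surjective.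
Qed.

Lemma isometry_of_property_star : property_star F -> bc_isometry F.
Proof.
move=> /point_map_injective_of_property_star/lift_surjective_of_injective.
exact: isometry_of_lift_surjective.
Qed.

End nonexpansive_bijection.

Unset Implicit Arguments.

Theorem theorem5p1 (R : realType) (K : topologicalType)
  (Kcpt : compact [set: K]) (Khaus : hausdorff_space K)
  (K0dim : clopen_basis K)
  (Kiso_dense : dense [set x : K | isolated_pt x])
  (K'Gdelta : Gdelta (@accum_pts K))
  (F : BC R K -> BC R K) (Fne : bc_non_expansive F) (Fbij : bijective F) :
  (property_star F \/ cond_ii F) -> bc_isometry F.
Proof.
case: Fbij => G FK GK [star|norm_bound].
- exact: (isometry_of_property_star Kcpt Khaus K0dim Kiso_dense K'Gdelta
    Fne FK GK).
- exact: (isometry_of_cond_ii Kcpt Khaus K0dim Kiso_dense K'Gdelta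
    Fne FK GK).
Qed.
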